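(* Let $\lambda=(1^{m_1}2^{m_2}\cdots N^{m_N})$ be a non-zero partition with largest part $N$, multiplicities $m=(m_1,m_2,\ldots)$ ($m_i=0$ for $i>N$) and number of parts $l(\lambda)=\sum_i m_i$. As a function of $g$ (integer $g\ge1$), the quantity $A_\lambda(1)$ is a polynomial of degree $l(\lambda)-1$; its leading coefficient in the variable $\rho:=2g-2$ is $$ \frac 1{P_1(m)\,P_{N}(m)}\prod_{i\geq 1} \frac{P_i(m)^{m_i}}{m_i!},\qquad P_i(m):=\sum_{j\ge1}\min(i,j)\,m_j . $$
   Context: Fix an integer $g\ge 1$. For a finite sequence $m=(m_1,\ldots,m_N)$ of non-negative integers and variables $x=(x_1,\ldots,x_N)$ put $x^m:=x_1^{m_1}\cdots x_N^{m_N}$, $(q)_n:=\prod_{k=1}^n(1-q^k)$ (so $(q^{-1})_n=\prod_{k=1}^n(1-q^{-k})$), and $(q^{-1})_m:=\prod_{i=1}^N (q^{-1})_{m_i}$. Let $\mathcal H_N$ be the $N\times N$ matrix with entries $\min(i,j)$, $1\le i,j\le N$. Define $$ \mathrm{Hua}_N(x;q):=\sum_{m\in\mathbb Z_{\ge0}^N}\frac{q^{(g-1)\,{}^tm\mathcal H_N m}}{(q^{-1})_m}\,x^m\in 1+(x_1,\dots,x_N)\,\mathbb Q(q)[[x_1,\ldots,x_N]]. $$ $\mathrm{Log}$ denotes the plethystic logarithm: for a power series $F$ over $\mathbb Q(q)$ with constant term $1$, $\mathrm{Log}(F):=\sum_{k\ge1}\frac{\mu(k)}{k}\,\psi_k(\log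 F)$, where $\mu$ is the Möbius function and $\psi_k$ replaces $q$ by $q^k$ and each $x_i$ by $x_i^k$; it takes products to sums and sends $(1-w)^{-1}$ to $w$ for a non-constant monomial $w$. The rational functions $A_m(q)\in\mathbb Q(q)$ (depending on $g$) are defined by $$ (q-1)\,\mathrm{Log}\big(\mathrm{Hua}_N(x;q)\big)=\sum_m A_m(q)\,x^m . $$ For a partition $\lambda=(1^{m_1}2^{m_2}\cdots N^{m_N})$ (i.e. $\lambda$ has exactly $m_i$ parts equal to $i$, and all parts are $\le N$) set $A_\lambda(q):=A_m(q)$, with $m=(m_1,\ldots,m_N)$; this does not depend on the choice of $N\ge\lambda_1$, where $\lambda_1$ is the largest part. $A_\lambda(1)$ is the value of the rational function $A_\lambda(q)$ at $q=1$. *)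

(* Defs.v *)
From mathcomp Require Export all_boot all_order all_algebra.
From mathcomp Require Export mpoly.

Set Implicit Arguments.
Unset Strict Implicit.
Unset Printing Implicit Defensive.

Import Order.TTheory GRing.Theory Num.Theory.
Local Open Scope ring_scope.

Notation "p %:F" := (@FracField.tofrac _ p) : ring_scope.
Notation Qq := {fraction {poly rat}}.

Definition q : Qq := ('X : {poly rat})%:F.

(* The rational function r is regular at a, where it takes the value v. *)
Definition frac_value (r : Qq) (a v : rat) : Prop :=
  exists n d : {poly rat},
    [/\ d.[a] != 0, r = n%:F / d%:F & v = n.[a] / d.[a]].

(* The substitution q |-> q ^ k in Q(q), for k > 0; the result does not
   depend on the representative chosen by repr. *)
Definition frac_psi (k : nat) (r : Qq) : Qq :=
  (\n_(repr r) \Po 'X^k)%:F / (\d_(repr r) \Po 'X^k)%:F.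

(* Only meaningful for n > 0. *)
Definition moebius (n : nat) : int :=
  if all (fun p => logn p n == 1%N) (primes n)
  then (-1) ^+ size (primes n) else 0.

(* (a)_n = (1 - a) (1 - a ^ 2) ... (1 - a ^ n) *)
Definition qpoch (a : Qq) (n : nat) : Qq :=
  \prod_(1 <= k < n.+1) (1 - a ^+ k).

Section PowerSeries.
Variable N : nat.

(* A power series in x_1, ..., x_N over Q(q) is its family of coefficients;
   the variable x_i has index i - 1 in 'I_N. *)
Definition mpseries := 'X_{1..N} -> Qq.

Definition mps_one : mpseries := fun m => (m == 0%MM)%:R.

(* Cauchy product, in the form of mcoeffM *)
Definition mps_mul (F G : mpseries) : mpseries := fun m =>
  \sum_(k : 'X_{1..N < (mdeg m).+1, (mdeg m).+1} | m == (k.1 + k.2)%MM)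
     F k.1 * G k.2.

Definition mps_exp (F : mpseries) (k : nat) : mpseries :=
  iter k (mps_mul F) mps_one.

(* log F = \sum_(k >= 1) (-1) ^ (k - 1) / k (F - 1) ^ k, for F with constant
   term 1. As (F - 1) ^ k has no term of total degree < k, the coefficient
   of x ^ m only involves k <= mdeg m. *)
Definition mps_log (F : mpseries) : mpseries := fun m =>
  \sum_(1 <= k < (mdeg m).+1)
     (-1) ^+ k.-1 / k%:R * mps_exp (fun u => F u - mps_one u) k m.

(* psi_k, for k > 0: q |-> q ^ k and x_i |-> x_i ^ k *)
Definition mps_psi (k : nat) (F : mpseries) : mpseries := fun m =>
  if [forall i : 'I_N, k %| m i]%N
  then frac_psi k (F [multinom (m i %/ k)%N | i < N]) else 0.

(* Log F = \sum_(k >= 1) mu(k) / k psi_k (log F). As log F has no constant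
   term, psi_k (log F) has no term of total degree < k, so that the
   coefficient of x ^ m only involves k <= mdeg m. *)
Definition mps_Log (F : mpseries) : mpseries := fun m =>
  \sum_(1 <= k < (mdeg m).+1)
     (moebius k)%:~R / k%:R * mps_psi k (mps_log F) m.

Definition H_mx : 'M[nat]_N := \matrix_(i, j) minn i.+1 j.+1.

Definition H_form (m : 'X_{1..N}) : nat :=
  (\sum_(i < N) \sum_(j < N) m i * H_mx i j * m j)%N.

Definition Hua (g : nat) : mpseries := fun m =>
  q ^ ((g%:Z - 1) * (H_form m)%:Z) / \prod_(i < N) qpoch q^-1 (m i).

Definition A_mult (g : nat) : mpseries := fun m =>
  (q - 1) * mps_Log (Hua g) m.

End PowerSeries.

(* Partitions are weakly decreasing sequences of positive integers. *)
Definition is_partition (la : seq nat) : bool :=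
  sorted geq la && (0%N \notin la).

Definition largest_part (la : seq nat) : nat := head 0%N la.

(* mult la i = m_i, the number of parts equal to i (for i >= 1) *)
Definition mult (la : seq nat) (i : nat) : nat := count_mem i la.

Definition A_part (g : nat) (la : seq nat) : Qq :=
  A_mult g [multinom mult la i.+1 | i < largest_part la].

(* P_i(m); m_j = 0 for j > largest_part la *)
Definition Pmin (la : seq nat) (i : nat) : nat :=
  (\sum_(1 <= j < (largest_part la).+1) minn i j * mult la j)%N.

(* Main.v *)
Require Import Defs.
From mathcomp Require Import ring zify.
From Stdlib Require Import FunctionalExtensionality.
Import Order.TTheory GRing.Theory Num.Theory.
Local Open Scope ring_scope.
Set Implicit Arguments.
Unset Strict Implicit.
Unset Printing Implicit Defensive.

(* Write F = Hua, rho = 2g - 2, and for t in N^N let F_t be F with each x_i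
   replaced by q^(t_i) x_i. The ratio r(t) = F_t / F satisfies the linear
   recurrence
     r_m(t) - r_m(t - e_i) = q^(...) r_(m - e_i)(t + rho H_i),   r(0) = 1,
   where H_i is the i-th row of H, so its coefficients are regular at q = 1.
   Their values there satisfy the same recurrence with q = 1, whose solution is
     (1 / m!) det (delta_ij <a_i>_(m_i) - rho H_ij m_i <a_i + 1>_(m_i - 1)),
   with <a>_n = a (a + 1) ... (a + n - 1) and a_i = t_i + rho P_i(m): only row i
   changes in the recurrence, and it does so by Pascal's rule.
   For t = (c, ..., c), the Euler derivation D gives D r = r D (L_t - L) with
   L = log F. Hence (q - 1) L is regular at q = 1, and its value at x^m is
   1 / |m| times the derivative at c = 0 of the limit of r_m(c, ..., c). As
   H_ij = min(i, j), the determinant for constant t is a product, and this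
   derivative is
     (1 / m!) <rho P_N + 1>_(m_N - 1) prod_(i < N) <rho P_i>_(m_i),
   a polynomial in rho of degree |m| - 1. In Log F the Adams operation psi_k
   only contributes degree |m| / k - 1 < |m| - 1 for k > 1. *)

(** * Values at a point of rational functions *)

Lemma tofrac_horner_neq0 (p : {poly rat}) a : p.[a] != 0 -> p%:F != 0.
Proof.
by apply: contraNneq => /eqP; rewrite tofrac_eq0 => /eqP ->; rewrite horner0.
Qed.

Lemma frac_value_uniq r a u v : frac_value r a u -> frac_value r a v -> u = v.
Proof.
move=> [n [d [d0 -> ->]]] [n' [d' [d'0 E ->]]].
have /eqP : n%:F * d'%:F = n'%:F * d%:F :> Qq.
  apply/eqP; rewrite -eqr_div; first exact/eqP.
  - exact: tofrac_horner_neq0 d0.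
  - exact: tofrac_horner_neq0 d'0.
rewrite -!tofracM tofrac_eq => /eqP/(congr1 (fun p => p.[a])).
by rewrite !hornerM => /eqP; rewrite -eqr_div // => /eqP.
Qed.

Lemma frac_value_poly (p : {poly rat}) a : frac_value p%:F a p.[a].
Proof.
by exists p, 1; rewrite hornerC oner_neq0 tofrac1 !divr1.
Qed.

Lemma frac_valueD r s a u v :
  frac_value r a u -> frac_value s a v -> frac_value (r + s) a (u + v).
Proof.
move=> [n [d [d0 -> ->]]] [n' [d' [d'0 -> ->]]].
exists (n * d' + n' * d), (d * d'); split.
- by rewrite hornerM mulf_neq0.
- rewrite addf_div ?tofracD ?tofracM //; first exact: tofrac_horner_neq0 d0.
  exact: tofrac_horner_neq0 d'0.
- by rewrite addf_div // hornerD !hornerM.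
Qed.

Lemma frac_valueM r s a u v :
  frac_value r a u -> frac_value s a v -> frac_value (r * s) a (u * v).
Proof.
move=> [n [d [d0 -> ->]]] [n' [d' [d'0 -> ->]]].
exists (n * n'), (d * d'); split.
- by rewrite hornerM mulf_neq0.
- by rewrite mulf_div !tofracM.
- by rewrite mulf_div !hornerM.
Qed.

Lemma frac_valueV r a u : u != 0 -> frac_value r a u -> frac_value r^-1 a u^-1.
Proof.
move=> u0 [n [d [d0 -> E]]]; exists d, n; rewrite E !invf_div; split=> //.
by move: u0; rewrite E mulf_eq0 invr_eq0 negb_or => /andP[].
Qed.

Lemma frac_value_nat n a : frac_value n%:R a n%:R.
Proof.
have := frac_value_poly n%:R a.
by rewrite rmorph_nat -polyC_natr hornerC.
Qed.

Lemma frac_valueN r a u : frac_value r a u -> frac_value (- r) a (- u).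
Proof.
move=> h; rewrite -mulN1r -[- u]mulN1r; apply: frac_valueM => //.
have := frac_value_poly (- 1) a.
by rewrite hornerN hornerC rmorphN rmorph1.
Qed.

Lemma frac_valueB r s a u v :
  frac_value r a u -> frac_value s a v -> frac_value (r - s) a (u - v).
Proof. by move=> hr hs; apply/frac_valueD/frac_valueN. Qed.

Lemma frac_value_int (z : int) a : frac_value z%:~R a z%:~R.
Proof.
by case: (intP z) => [|n|n]; rewrite ?mulrNz -?pmulrn;
  [exact: (frac_value_nat 0) | exact: frac_value_nat
  | exact/frac_valueN/frac_value_nat].
Qed.

Lemma frac_value_sum I (s : seq I) (P : pred I) r (v : I -> rat) a :
  (forall i, P i -> frac_value (r i) a (v i)) ->
  frac_value (\sum_(i <- s | P i) r i) a (\sum_(i <- s | P i) v i).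
Proof.
move=> h; apply: (big_ind2 (fun x y => frac_value x a y)) => //.
  exact: (frac_value_nat 0).
by move=> *; apply: frac_valueD.
Qed.

Lemma frac_value_qX n : frac_value (q ^+ n) 1 1.
Proof.
rewrite /q -tofracXn; have := frac_value_poly 'X^n 1.
by rewrite hornerXn expr1n.
Qed.

Lemma frac_numdenE (R : idomainType) (r : {fraction R}) :
  r = (\n_(repr r))%:F / (\d_(repr r))%:F.
Proof.
have d0 : \d_(repr r) != 0 by apply: denom_ratioP.
apply: (canRL (mulfK _)); rewrite ?tofrac_eq0 //.
rewrite -[X in X * _]reprK; unlock tofrac; rewrite -[LHS]FracField.pi_mul.
apply/eqmodP; rewrite /= FracField.equivfE /FracField.mulf /= !numden_Ratio
  ?oner_eq0 ?mulf_neq0 //; try exact: oner_neq0.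
by rewrite !mulr1 mulrC.
Qed.
Lemma comp_polyXn_eq0 (p : {poly rat}) k : (0 < k)%N -> (p \Po 'X^k == 0) = (p == 0).
Proof.
by move=> k0; rewrite comp_poly_eq0 // size_polyXn.
Qed.

(** Two representatives of a fraction satisfy a cross-multiplied polynomial identity, and
    composition with ['X^k] preserves it; hence [frac_psi] can be computed on any representative. *)
Lemma frac_psiE k (n d : {poly rat}) : (0 < k)%N -> d != 0 ->
  frac_psi k (n%:F / d%:F) = (n \Po 'X^k)%:F / (d \Po 'X^k)%:F.
Proof.
move=> k0 d0; rewrite /frac_psi.
set r := _ / d%:F; have E := frac_numdenE r.
have e0 : \d_(repr r) != 0 by apply: denom_ratioP.
apply/eqP; rewrite eqr_div ?tofrac_eq0 ?comp_polyXn_eq0 //.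
rewrite -!tofracM -!comp_polyM tofrac_eq; apply/eqP; congr (_ \Po _).
apply/eqP; rewrite -tofrac_eq !tofracM -eqr_div ?tofrac_eq0 //.
by rewrite -E.
Qed.

(* (q - 1) / (q ^ k - 1) has value 1 / k at q = 1. *)
Lemma frac_value_psi k L v : (0 < k)%N ->
  frac_value ((q - 1) * L) 1 v ->
  frac_value ((q - 1) * frac_psi k L) 1 (v / k%:R).
Proof.
move=> k0 [n [d [d1 E ->]]].
have X1 : 'X - 1 != 0 :> {poly rat} by rewrite -(polyC1) polyXsubC_eq0.
have q1 : q - 1 = ('X - 1 : {poly rat})%:F by rewrite /q tofracB tofrac1.
have d0 := tofrac_horner_neq0 d1.
have q10 : q - 1 != 0 by rewrite q1 tofrac_eq0.
have -> : L = n%:F / (d * ('X - 1))%:F.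
  by rewrite tofracM -q1 invfM mulrA -E mulrAC divff // mul1r.
rewrite frac_psiE // ?mulf_neq0 //; last by rewrite -tofrac_eq0.
(* The geometric sum is [('X^k - 1) / ('X - 1)], which is what remains after cancelling [q - 1]. *)
exists (n \Po 'X^k), ((d \Po 'X^k) * \sum_(i < k) 'X^i).
have S1 : (\sum_(i < k) 'X^i : {poly rat}).[1] = k%:R.
  rewrite horner_sum (eq_bigr (fun=> 1)) ?sumr_const ?card_ord //.
  by move=> i _; rewrite hornerXn expr1n.
split.
- by rewrite hornerM S1 horner_comp hornerXn expr1n mulf_neq0 ?pnatr_eq0 -?lt0n.
- rewrite comp_polyM comp_polyB comp_polyX comp_polyC subrX1 mulrCA !tofracM -q1.
  by congr (_ * _); rewrite !invfM mulrCA mulVKf.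
- by rewrite hornerM S1 !horner_comp hornerXn expr1n invfM mulrA.
Qed.

Lemma natr_Qq_eq0 n : (n%:R == 0 :> Qq) = (n == 0)%N.
Proof.
rewrite -[n%:R](rmorph_nat (@FracField.tofrac {poly rat})) tofrac_eq0.
by rewrite -polyC_natr polyC_eq0 pnatr_eq0.
Qed.

(** * Power series *)

Lemma mnm_neq0_ex N (m : 'X_{1..N}) : m != 0%MM -> exists i, m i != 0%N.
Proof.
move=> m0; apply/existsP; rewrite -negb_forall; apply: contra m0 => /forallP h.
by apply/eqP/mnmP => i; rewrite mnm0E; apply/eqP.
Qed.

Lemma mnm_subK1 N (m : 'X_{1..N}) i : m i != 0%N -> (m - U_(i) + U_(i))%MM = m.
Proof.
move=> h; rewrite submK //; apply/mnm_lepP => j.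
by rewrite mnm1E; case: eqP => // <-; rewrite lt0n.
Qed.

Section MpSeries.
Variable N : nat.
Implicit Types (F G H : mpseries N) (m : 'X_{1..N}).

(** A coefficient of a product involves only coefficients of at most its own degree, so products can
    be computed on truncations, where the ring laws of [{mpoly Qq[N]}] apply. *)
Definition mps_trunc d F : {mpoly Qq[N]} :=
  \sum_(m : 'X_{1..N < d.+1}) F m *: 'X_[m].

Lemma mcoeff_trunc d F m : (mdeg m <= d)%N -> (mps_trunc d F)@_m = F m.
Proof. by move=> h; rewrite /mps_trunc mcoeff_mpoly. Qed.

Lemma mcoeffM_congr (p p' r r' : {mpoly Qq[N]}) m :
  (forall k, (mdeg k <= mdeg m)%N -> p@_k = p'@_k) ->
  (forall k, (mdeg k <= mdeg m)%N -> r@_k = r'@_k) ->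
  (p * r)@_m = (p' * r')@_m.
Proof.
move=> hp hr; rewrite !mcoeffM; apply: eq_bigr => k _.
by rewrite hp ?hr // -ltnS bmdeg.
Qed.

Lemma mps_mulE d F G m : (mdeg m <= d)%N ->
  mps_mul F G m = (mps_trunc d F * mps_trunc d G)@_m.
Proof.
move=> h; rewrite mcoeffM; apply: eq_bigr => k _.
by rewrite !mcoeff_trunc // (leq_trans _ h) // -ltnS bmdeg.
Qed.

Lemma mps_mulC F G : mps_mul F G = mps_mul G F.
Proof.
apply: functional_extensionality => m.
by rewrite (mps_mulE F G (leqnn _)) (mps_mulE G F (leqnn _)) mulrC.
Qed.

Lemma mps_mulA F G H : mps_mul F (mps_mul G H) = mps_mul (mps_mul F G) H.
Proof.
apply: functional_extensionality => m; rewrite (mps_mulE F _ (leqnn _)).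
rewrite (mps_mulE (mps_mul F G) H (leqnn _)).
have E A B : forall k, (mdeg k <= mdeg m)%N ->
    (mps_trunc (mdeg m) (mps_mul A B))@_k
      = (mps_trunc (mdeg m) A * mps_trunc (mdeg m) B)@_k.
  by move=> k h; rewrite mcoeff_trunc // (mps_mulE (d := mdeg m)).
rewrite (mcoeffM_congr (p' := mps_trunc _ F) (fun _ _ => erefl) (@E G H)).
rewrite (mcoeffM_congr (r' := mps_trunc _ H) (@E F G) (fun _ _ => erefl)).
by rewrite mulrA.
Qed.

Lemma mps_mulCA F G H : mps_mul F (mps_mul G H) = mps_mul G (mps_mul F H).
Proof. by rewrite !mps_mulA (mps_mulC F). Qed.

Lemma mps_mulDr F G H m :
  mps_mul F (fun u => G u + H u) m = mps_mul F G m + mps_mul F H m.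
Proof. by rewrite -big_split; apply: eq_bigr => k _; rewrite mulrDr. Qed.

Lemma mps_mulBr F G H m :
  mps_mul F (fun u => G u - H u) m = mps_mul F G m - mps_mul F H m.
Proof. by rewrite -sumrB; apply: eq_bigr => k _; rewrite mulrBr. Qed.

Lemma mps_mulZr F (c : Qq) G m :
  mps_mul F (fun u => c * G u) m = c * mps_mul F G m.
Proof. by rewrite mulr_sumr; apply: eq_bigr => k _; rewrite mulrCA. Qed.

Lemma mps_mul_sumr F I (s : seq I) (P : pred I) (G : I -> mpseries N) m :
  mps_mul F (fun u => \sum_(i <- s | P i) G i u) m
    = \sum_(i <- s | P i) mps_mul F (G i) m.
Proof.
by rewrite exchange_big; apply: eq_bigr => k _; rewrite mulr_sumr.
Qed.

Lemma mps_mul_local F F' G G' m :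
  (forall k, (mdeg k <= mdeg m)%N -> F k = F' k) ->
  (forall k, (mdeg k <= mdeg m)%N -> G k = G' k) ->
  mps_mul F G m = mps_mul F' G' m.
Proof.
move=> hF hG; apply: eq_bigr => k _.
by rewrite hF ?hG // -ltnS bmdeg.
Qed.

Lemma mps_mul1l F : mps_mul (@mps_one N) F = F.
Proof.
apply: functional_extensionality => m.
rewrite (mps_mulE (d := mdeg m)) // (mcoeffM_congr (p' := 1) (r' := mps_trunc (mdeg m) F)) //.
  by rewrite mul1r mcoeff_trunc.
by move=> k h; rewrite mcoeff_trunc // mcoeff1.
Qed.

Lemma mps_mul1r F : mps_mul F (@mps_one N) = F.
Proof. by rewrite mps_mulC mps_mul1l. Qed.

(* The Euler derivation sum_i x_i d/dx_i. *)
Definition mps_euler F : mpseries N := fun m => (mdeg m)%:R * F m.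

Lemma mps_eulerM F G m :
  mps_euler (mps_mul F G) m
    = mps_mul (mps_euler F) G m + mps_mul F (mps_euler G) m.
Proof.
rewrite /mps_euler mulr_sumr -big_split; apply: eq_bigr => k /eqP E /=.
have -> : (mdeg m)%:R = (mdeg k.1)%:R + (mdeg k.2)%:R :> Qq.
  by rewrite -natrD -mdegD -E.
by rewrite mulrDl mulrA; congr (_ + _); rewrite mulrCA.
Qed.

Lemma mps_exp_lt F k m : F 0%MM = 0 -> (mdeg m < k)%N -> mps_exp F k m = 0.
Proof.
move=> F0; elim: k m => // k IH m h; rewrite /mps_exp iterS -/(mps_exp F k).
apply: big1 => -[a b] /= /eqP E.
have [a0|a0] := eqVneq (a : 'X_{1..N}) 0%MM; first by rewrite a0 F0 mul0r.
rewrite IH ?mulr0 //; have := congr1 (@mdeg _) E; rewrite mdegD.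
by move: a0 h; rewrite -mdeg_eq0; lia.
Qed.

Lemma mps_expS F k : mps_exp F k.+1 = mps_mul F (mps_exp F k).
Proof. by []. Qed.

Lemma mps_euler_exp F k m :
  mps_euler (mps_exp F k.+1) m
    = k.+1%:R * mps_mul (mps_euler F) (mps_exp F k) m.
Proof.
elim: k m => [|k IH] m.
  rewrite mps_expS mps_mul1r mps_mul1r mul1r. by [].
rewrite mps_expS mps_eulerM.
rewrite [X in _ + X](mps_mul_local (F' := F)
  (G' := fun u => k.+1%:R * mps_mul (mps_euler F) (mps_exp F k) u)); last 2 first.
- by [].
- by move=> u _; apply: IH.
by rewrite mps_mulZr mps_mulCA -mps_expS [in RHS]mulrSr mulrDl mul1r addrC.
Qed.

(* The inverse of 1 + F, for F without constant term. *)
Definition mps_geom F : mpseries N := fun m =>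
  \sum_(k < (mdeg m).+1) (-1) ^+ k * mps_exp F k m.

(** Allows one common cutoff for all the coefficients that enter a product. *)
Lemma mps_geomE F m d : F 0%MM = 0 -> (mdeg m < d)%N ->
  mps_geom F m = \sum_(k < d) (-1) ^+ k * mps_exp F k m.
Proof.
move=> F0 h; rewrite /mps_geom (big_ord_widen d (fun k => (-1) ^+ k * mps_exp F k m)) //.
rewrite [RHS](bigID (fun k : 'I_d => (k < (mdeg m).+1)%N)) /= [X in _ + X]big1 ?addr0 //.
by move=> k; rewrite -leqNgt => hk; rewrite mps_exp_lt // mulr0.
Qed.

Definition mps_sub1 F : mpseries N := fun u => F u - mps_one u.

Definition mps_inv F := mps_geom (mps_sub1 F).

Lemma mps_mulV F : F 0%MM = 1 -> mps_mul F (mps_inv F) = @mps_one N.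
Proof.
move=> F1; set f := mps_sub1 F.
have f0 : f 0%MM = 0 by rewrite /f /mps_sub1 F1 /mps_one eqxx subrr.
apply: functional_extensionality => m; rewrite mps_mulC.
rewrite (mps_mul_local (F' := mps_geom f) (G' := fun u => mps_one u + f u)) //; last first.
  by move=> u _; rewrite /f /mps_sub1 addrC subrK.
rewrite mps_mulDr mps_mul1r.
rewrite mps_mulC (mps_geomE f0 (ltnSn _)).
rewrite (mps_mul_local (F' := f)
  (G' := fun u => \sum_(k < (mdeg m).+1) (-1) ^+ k * mps_exp f k u)) //; last first.
  by move=> k h; apply: mps_geomE.
(* The product telescopes to 1 plus a signed power of [f] with exponent [(mdeg m).+1], which has no
   coefficient at [m]. *)
rewrite mps_mul_sumr -big_split /=.
rewrite (eq_bigr (fun k : 'I_(mdeg m).+1 =>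
   - ((-1) ^+ k.+1 * mps_exp f k.+1 m - (-1) ^+ k * mps_exp f k m))); last first.
  by move=> k _; rewrite mps_mulZr -mps_expS exprS; ring.
rewrite sumrN -(big_mkord xpredT (fun k =>
  (-1) ^+ k.+1 * mps_exp f k.+1 m - (-1) ^+ k * mps_exp f k m)).
by rewrite telescope_sumr // mps_exp_lt // mulr0 sub0r opprK mul1r.
Qed.

(** With f = F - 1 and D the Euler derivation, D(f^k) / k = f^(k-1) D f turns the series of the
    logarithm into the geometric series of [mps_inv]. *)
Lemma mps_euler_log F : F 0%MM = 1 ->
  mps_euler (mps_log F) = mps_mul (mps_euler F) (mps_inv F).
Proof.
move=> F1; set f := mps_sub1 F.
have f0 : f 0%MM = 0 by rewrite /f /mps_sub1 F1 /mps_one eqxx subrr.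
have Ef : mps_euler F = mps_euler f.
  apply: functional_extensionality => u; rewrite /mps_euler /f /mps_sub1 /mps_one.
  by case: eqP => [->|_]; rewrite ?mdeg0 ?mul0r // subr0.
apply: functional_extensionality => m; rewrite Ef.
rewrite (mps_mul_local (F' := mps_euler f)
  (G' := fun u => \sum_(k < (mdeg m).+1) (-1) ^+ k * mps_exp f k u)) //; last first.
  by move=> k h; apply: mps_geomE.
(* The geometric sum has one term more than the logarithm. It vanishes: [mps_euler f] has no
   constant term and [mps_exp f (mdeg m)] starts in degree [mdeg m]. *)
rewrite mps_mul_sumr big_ord_recr /= [X in _ + X](_ : _ = 0) ?addr0; last first.
  rewrite mps_mulZr; apply/eqP; rewrite mulf_eq0; apply/orP; right; apply/eqP.
  apply: big1 => -[a b] /= /eqP E.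
  have [a0|a0] := eqVneq (a : 'X_{1..N}) 0%MM.
    by rewrite /mps_euler a0 mdeg0 !mul0r.
  rewrite mps_exp_lt ?mulr0 //; have := congr1 (@mdeg _) E; rewrite mdegD.
  by move: a0; rewrite -mdeg_eq0; lia.
rewrite /mps_euler /mps_log mulr_sumr big_add1 /= big_mkord.
apply: eq_bigr => k _; rewrite mps_mulZr.
have := mps_euler_exp f k m; rewrite /mps_euler mulrCA => ->.
by rewrite mulrA divfK // natr_Qq_eq0.
Qed.



(** Leibniz rule on [F] times its inverse, using D(1) = 0. *)
Lemma mps_eulerV F : F 0%MM = 1 ->
  mps_euler (mps_inv F)
    = fun m => - mps_mul (mps_inv F) (mps_euler (mps_log F)) m.
Proof.
move=> F1; rewrite mps_euler_log //.
have h : mps_mul F (mps_euler (mps_inv F)) = fun u => -1 * mps_mul (mps_euler F) (mps_inv F) u.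
  apply: functional_extensionality => u.
  apply/eqP; rewrite mulN1r -addr_eq0 addrC -mps_eulerM mps_mulV //.
  rewrite /mps_euler /mps_one; have [->|_] := eqVneq u 0%MM.
    by rewrite mdeg0 mul0r.
  by rewrite mulr0.
rewrite -[LHS]mps_mul1l -(mps_mulV F1) (mps_mulC F) -mps_mulA h.
by apply: functional_extensionality => m; rewrite mps_mulZr mulN1r.
Qed.

End MpSeries.

(** * The q-difference equations of Hua *)

Lemma q_neq0 : q != 0.
Proof. by rewrite /q tofrac_eq0 polyX_eq0. Qed.

Lemma qX_neq1 k : q ^+ k.+1 != 1.
Proof.
rewrite /q -tofracXn -tofrac1 tofrac_eq; apply/eqP.
by move=> /(congr1 (fun p : {poly rat} => size p)); rewrite size_polyXn size_poly1.
Qed.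

Lemma qpochS n : qpoch q^-1 n.+1 = qpoch q^-1 n * (1 - q ^- n.+1).
Proof. by rewrite /qpoch big_nat_recr //= exprVn. Qed.

Section HuaRec.
Variables (N g : nat).
Implicit Types (t m : 'X_{1..N}) (i : 'I_N) (F G : mpseries N).

Definition mdot t m := (\sum_i t i * m i)%N.

(** The substitution x_i -> q^(t_i) x_i, written [F_t] in the opening comment. *)
Definition mps_scale t F : mpseries N := fun m => q ^+ mdot t m * F m.

Definition H_row i m := (\sum_(j < N) minn i.+1 j.+1 * m j)%N.

(** This is rho H_i. The genus is [g.+1] from here on, so that rho = [2 * g] and the exponents of
    [q] in [Hua] are natural numbers. *)
Definition H_shift i : 'X_{1..N} := [multinom (2 * g * minn i.+1 j.+1)%N | j < N].

Lemma sum_delta (f : 'I_N -> nat) i : (\sum_j f j * (i == j) = f i)%N.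
Proof.
rewrite (bigD1 i) //= eqxx muln1 big1 ?addn0 // => j /negPf.
by rewrite eq_sym => ->; rewrite muln0.
Qed.

Lemma mdot1 t i : mdot t U_(i) = t i.
Proof. by rewrite -[RHS]sum_delta; apply: eq_bigr => j _; rewrite mnm1E. Qed.

Lemma mdotC t m : mdot t m = mdot m t.
Proof. by apply: eq_bigr => j _; rewrite mulnC. Qed.

Lemma mdotDl t t' m : mdot (t + t') m = (mdot t m + mdot t' m)%N.
Proof. by rewrite -big_split; apply: eq_bigr => j _; rewrite mnmDE mulnDl. Qed.

Lemma mdotDr t m m' : mdot t (m + m') = (mdot t m + mdot t m')%N.
Proof. by rewrite !(mdotC t) mdotDl. Qed.

Lemma mdot_shift i m : mdot (H_shift i) m = (2 * g * H_row i m)%N.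
Proof. by rewrite /H_row big_distrr; apply: eq_bigr => j _; rewrite mnmE /= mulnA. Qed.

Lemma H_formE m : H_form m = (\sum_i m i * H_row i m)%N.
Proof.
apply: eq_bigr => i _; rewrite /H_row big_distrr; apply: eq_bigr => j _ /=.
by rewrite mxE mulnA.
Qed.

Lemma H_rowD1 j i m : H_row j (m + U_(i)) = (H_row j m + minn i.+1 j.+1)%N.
Proof.
rewrite -[X in (_ + X)%N](minnC j.+1) -(sum_delta (fun k => minn j.+1 k.+1)) -big_split.
by apply: eq_bigr => k _; rewrite mnmDE mnm1E mulnDr.
Qed.

Lemma H_formD1 i m : H_form (m + U_(i)) = (H_form m + i.+1 + 2 * H_row i m)%N.
Proof.
rewrite !H_formE (eq_bigr (fun j => m j * H_row j m + minn i.+1 j.+1 * m j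
   + (H_row j m + minn i.+1 j.+1) * (i == j)))%N.
  by rewrite !big_split /= -/(H_row i m) sum_delta minnn; lia.
by move=> j _; rewrite H_rowD1 mnmDE mnm1E; lia.
Qed.

Local Notation F := (@Hua N g.+1).

Lemma HuaE m : F m = q ^+ (g * H_form m) / \prod_(i < N) qpoch q^-1 (m i).
Proof.
rewrite /Hua; congr (_ / _); rewrite exprnP; congr (_ ^ _).
by rewrite -addn1 PoszD addrK PoszM.
Qed.

Lemma Hua0 : F 0%MM = 1.
Proof.
rewrite HuaE big1 ?divr1; last by move=> i _; rewrite mnm0E /qpoch big_geq.
rewrite H_formE big1 ?muln0 // => i _; by rewrite mnm0E.
Qed.

Lemma HuaD1 m i :
  F (m + U_(i))%MM * (1 - q ^- (m i).+1) = q ^+ (g * (i.+1 + 2 * H_row i m)) * F m.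
Proof.
rewrite !HuaE H_formD1 (bigD1 i) //= [in RHS](bigD1 i) //=.
rewrite (eq_bigr (fun j => qpoch q^-1 (m j))); last first.
  by move=> j /negPf h; rewrite mnmDE mnm1E eq_sym h addn0.
rewrite mnmDE mnm1E eqxx addn1 qpochS.
set A := qpoch _ _; set B := \prod_(_ < _ | _) _; set c := 1 - _.
have c0 : c != 0 by rewrite subr_eq0 eq_sym invr_eq1 qX_neq1.
rewrite -addnA mulnDr exprD (mulrAC A c B) invfM -[LHS]mulrA mulfVK //.
by rewrite [LHS]mulrAC [LHS]mulrC.
Qed.

(** Raising [t i] produces a factor 1 - q^-(m_i + 1), which cancels the last factor of the
    q-Pochhammer symbol. The part of the remaining exponent that is linear in [m] is absorbed as the
    shift of [t] by [H_shift i]. *)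
Lemma Hua_scale_step t m i :
  mps_scale (t + U_(i))%MM F (m + U_(i))%MM - mps_scale t F (m + U_(i))%MM
    = q ^+ ((t i).+1 + g * i.+1) * mps_scale (t + U_(i) + H_shift i)%MM F m.
Proof.
rewrite /mps_scale -mulrBl.
have -> : mdot (t + U_(i)) (m + U_(i)) = (mdot t (m + U_(i)) + (m i).+1)%N.
  by rewrite mdotDl; congr (_ + _)%N; rewrite mdotC mdot1 mnmDE mnm1E eqxx addn1.
have -> : q ^+ (mdot t (m + U_(i)) + (m i).+1) - q ^+ mdot t (m + U_(i))
    = q ^+ (mdot t (m + U_(i)) + (m i).+1) * (1 - q ^- (m i).+1).
  by rewrite mulrBr mulr1 [in X in _ = _ - X]exprD mulfK // expf_neq0 // q_neq0.
rewrite -mulrA [X in _ * X]mulrC HuaD1 !mulrA -!exprD; congr (q ^+ _ * _).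
rewrite !mdotDl mdot_shift mdotDr mdot1 [mdot U_(i) _]mdotC mdot1; lia.
Qed.

Lemma Hua_scale_step0 t m i : m i = 0%N ->
  mps_scale (t + U_(i))%MM F m = mps_scale t F m.
Proof. by move=> h; rewrite /mps_scale mdotDl (mdotC U_(i)) mdot1 h addn0. Qed.

Definition hua_ratio t := mps_mul (mps_scale t F) (mps_inv F).

Lemma hua_ratio0 : hua_ratio 0%MM = @mps_one N.
Proof.
rewrite -(mps_mulV Hua0); congr mps_mul; apply: functional_extensionality => m.
by rewrite /mps_scale /mdot big1 ?mul1r // => i _; rewrite mnm0E.
Qed.

Lemma hua_ratio_step0 t m i : m i = 0%N ->
  hua_ratio (t + U_(i))%MM m = hua_ratio t m.
Proof.
move=> h; apply: eq_bigr => k /eqP E; congr (_ * _).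
apply: Hua_scale_step0; have := congr1 (fun u : 'X_{1..N} => u i) E.
by rewrite h mnmDE; lia.
Qed.

(** As series, F_(t + e_i) - F_t = c x_i F_(t + e_i + rho H_i) with c a power of q; this is divided
    by F. *)
Lemma hua_ratio_step t m i :
  hua_ratio (t + U_(i))%MM (m + U_(i))%MM - hua_ratio t (m + U_(i))%MM
    = q ^+ ((t i).+1 + g * i.+1) * hua_ratio (t + U_(i) + H_shift i)%MM m.
Proof.
set c := q ^+ _; set E := mps_scale (t + U_(i) + H_shift i)%MM F.
set A := mps_scale (t + U_(i))%MM F; set B := mps_scale t F.
rewrite /hua_ratio -/A -/B -/E !(mps_mulC _ (mps_inv F)) -mps_mulBr.
rewrite (mps_mulE _ _ (leqnn _)).
rewrite (mcoeffM_congr (p' := mps_trunc (mdeg (m + U_(i))) (mps_inv F))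
   (r' := c *: (mps_trunc (mdeg (m + U_(i))) E * 'X_i))) //; last first.
  move=> k h; rewrite mcoeff_trunc // mcoeffZ.
  (* For [k i = 0] both sides vanish: the two scalings agree, and x_i divides the right-hand
     side. *)
  have [k0|k0] := eqVneq (k i) 0%N.
    rewrite /A /B Hua_scale_step0 // subrr mulrC mcoeffM big1 ?mul0r //.
    move=> [a b] /= /eqP e; rewrite [X in _ * X]mcoeffX; case: eqP => [eb|]; rewrite ?mulr0 //.
    have := congr1 (fun u : 'X_{1..N} => u i) e.
    by rewrite k0 mnmDE -eb mnm1E eqxx addn1.
  rewrite -(mnm_subK1 k0) addmC in h *.
  rewrite mcoeffMX mcoeff_trunc; last first.
    by apply: leq_trans h; rewrite mdegD leq_addl.
  by rewrite addmC Hua_scale_step.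
rewrite -scalerAr mcoeffZ mulrA addmC mcoeffMX; congr (_ * _).
by rewrite (mps_mulE (d := mdeg (U_(i) + m))) // mdegD leq_addl.
Qed.

End HuaRec.

(** * The determinant *)

Section Rise.
Variable R : comNzRingType.
Implicit Types (a : R) (n : nat).

Definition rise a n : R := \prod_(k < n) (a + k%:R).

Lemma riseSr a n : rise a n.+1 = rise a n * (a + n%:R).
Proof. by rewrite /rise big_ord_recr. Qed.

Lemma riseSl a n : rise a n.+1 = a * rise (a + 1) n.
Proof.
rewrite /rise big_ord_recl addr0; congr (_ * _); apply: eq_bigr => k _.
by rewrite -addrA -natr1 [1 + _]addrC.
Qed.

Lemma rise_diff a n : rise a n.+1 - rise (a - 1) n.+1 = n.+1%:R * rise a n.
Proof. by rewrite riseSr riseSl subrK; ring. Qed.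

Lemma rise_diff1 a n : rise (a + 1) n - rise a n = n%:R * rise (a + 1) n.-1.
Proof.
case: n => [|n]; first by rewrite /rise !big_ord0 subrr mul0r.
by rewrite -[in X in _ - X](addrK 1 a) rise_diff.
Qed.

End Rise.

Lemma sum_mulr_delta (R : pzRingType) (I : finType) (f : I -> R) c :
  \sum_k f k * (k == c)%:R = f c.
Proof.
rewrite (bigD1 c) //= eqxx mulr1 big1 ?addr0 // => k /negPf ->.
by rewrite mulr0.
Qed.

Section Det.
Variables (R : comNzRingType) (N : nat) (rho : R).
Implicit Types (m : 'X_{1..N}) (a : 'I_N -> R).

(** When [m i = 0], row [i] is that of the identity: the truncated [.-1] is multiplied by zero. *)
Definition hua_mx m a : 'M[R]_N := \matrix_(i, j)
  (rise (a i) (m i) * (i == j)%:R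
   - rho * (minn i.+1 j.+1)%:R * ((m i)%:R * rise (a i + 1) (m i).-1)).

(** The matrices agree off row [i], where the determinant is linear; there [rise_diff] treats the
    diagonal term and [rise_diff1] the subtracted one. *)
Lemma det_hua_mx_step m a (i : 'I_N) :
  \det (hua_mx (m + U_(i)) a)
    - \det (hua_mx (m + U_(i)) (fun j => a j - (i == j)%:R))
  = (m i).+1%:R * \det (hua_mx m a).
Proof.
set A := hua_mx _ a; set B := hua_mx _ (fun _ => _).
rewrite (@determinant_multilinear _ _ A B (hua_mx m a) i 1 (m i).+1%:R).
- by rewrite mul1r addrAC subrr add0r.
- apply/rowP => j; rewrite !mxE !mnmDE !mnm1E !eqxx !addn1 /= mul1r.
  have /eqP := rise_diff1 (a i) (m i); rewrite subr_eq => /eqP E1.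
  have /eqP := rise_diff (a i) (m i); rewrite subr_eq => /eqP E2.
  by rewrite subrK E1 E2; ring.
- apply/matrixP => k l; rewrite !mxE.
  by rewrite (negPf (neq_lift i k)) subr0.
- apply/matrixP => k l; rewrite !mxE !mnmDE !mnm1E.
  by rewrite (negPf (neq_lift i k)) !addn0.
Qed.

(** This is the initial value at t = 0: once common row factors are removed, a weighted sum of the
    rows is zero. *)
Lemma det_hua_mx_eq0 m a : m != 0%MM ->
  (forall j, a j = rho * (\sum_(i < N) minn i.+1 j.+1 * m i)%:R) ->
  \det (hua_mx m a) = 0.
Proof.
move=> m0 ha.
have [i0 mi0] := mnm_neq0_ex m0.
pose d := \row_i (if m i == 0%N then 1 else rise (a i + 1) (m i).-1).
pose K := \matrix_(i, j) (if m i == 0%N then (i == j)%:R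
   else a i * (i == j)%:R - rho * (minn i.+1 j.+1)%:R * (m i)%:R).
have -> : hua_mx m a = diag_mx d *m K.
  apply/matrixP => i j; rewrite mul_diag_mx !mxE.
  case: (m i) => [|n] /=; first by rewrite /rise big_ord0 mul0r mulr0 subr0.
  by rewrite riseSl; ring.
(* With weight 1 on the rows where [m i] is nonzero, column [j] sums to [a j] minus rho P_j; the
   identity rows need weight [a i] to supply their share of [a j]. *)
pose v := \row_i (if m i == 0%N then a i else 1).
have vK : v *m K = 0.
  apply/rowP => j; rewrite !mxE.
  rewrite (eq_bigr (fun i => a i * (i == j)%:R
      - rho * (minn i.+1 j.+1 * m i)%:R)); last first.
    move=> i _; rewrite !mxE natrM; case: (m i) => [|n] /=; ring.
  rewrite sumrB -mulr_sumr -natr_sum -ha (bigD1 j) //= eqxx mulr1 big1 ?addr0 ?subrr //.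
  by move=> i /negPf ->; rewrite mulr0.
rewrite det_mulmx; suff -> : \det K = 0 by rewrite mulr0.
(* Multiplying by the adjugate gives [\det K] times [v], and [v] has entry 1 at [i0]. *)
have : v *m K *m \adj K = 0 by rewrite vK mul0mx.
rewrite -mulmxA mul_mx_adj mul_mx_scalar => /rowP/(_ i0).
by rewrite !mxE (negPf mi0) mulr1.
Qed.

End Det.

Lemma det_diag_sub_min (R : comNzRingType) n (rho x : R) (m : 'I_n.+1 -> nat) (a : 'I_n.+1 -> R) :
  (forall j, a j = x + rho * (\sum_(i < n.+1) minn i.+1 j.+1 * m i)%:R) ->
  \det (\matrix_(i, j) (a i * (i == j)%:R - rho * (minn i.+1 j.+1)%:R * (m i)%:R))
    = x * \prod_(i < n) a (lift ord_max i).
Proof.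
move=> ha; set K := \matrix_(i, j) _.
(* [U] replaces the last row by the sum of all rows, which is constantly [x]; [V] subtracts from
   each column the next one. Both are unitriangular. *)
pose U : 'M[R]_n.+1 := \matrix_(i, j) (if i == ord_max then 1 else (i == j)%:R).
pose V : 'M[R]_n.+1 := \matrix_(i, j) ((i == j)%:R - (i == j.+1 :> nat)%:R).
have dU : \det U = 1.
  rewrite det_trig ?big1 //.
    by move=> i _; rewrite mxE eqxx; case: ifP.
  apply/is_trig_mxP => i j ij; rewrite mxE.
  case: eqP => [E|_]; first by move: ij (ltn_ord j); rewrite E /=; lia.
  by case: eqP ij => // ->; rewrite ltnn.
have dV : \det V = 1.
  rewrite det_trig ?big1 //.
    by move=> i _; rewrite mxE eqxx; case: eqP => [|_]; [lia | rewrite subr0].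
  apply/is_trig_mxP => i j ij; rewrite mxE.
  case: eqP ij => [->|_ ij]; first by rewrite ltnn.
  by case: eqP => [|_]; [lia | rewrite subrr].
have UK : U *m K = \matrix_(i, j) (if i == ord_max then x else K i j).
  apply/matrixP => i j; rewrite !mxE; have [->|ni] := eqVneq i ord_max.
    rewrite (eq_bigr (fun i => a i * (i == j)%:R
      - rho * (minn i.+1 j.+1 * m i)%:R)); last first.
      by move=> k _; rewrite !mxE eqxx mul1r natrM mulrA.
    by rewrite sumrB -mulr_sumr -natr_sum sum_mulr_delta ha addrK.
  rewrite (eq_bigr (fun k => K k j * (k == i)%:R)) ?sum_mulr_delta ?mxE //.
  by move=> k _; rewrite [U _ _]mxE (negPf ni) mulrC eq_sym.
have -> : \det K = \det (U *m K *m V).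
  by rewrite !det_mulmx dU dV mul1r mulr1.
rewrite UK.
set E := _ *m V.
have EV i j : E i j = \sum_k (if i == ord_max then x else K i k) * (k == j)%:R
    - \sum_k (if i == ord_max then x else K i k) * (k == j.+1 :> nat)%:R.
  by rewrite mxE -sumrB; apply: eq_bigr => k _; rewrite !mxE mulrBr.
have Emax i : E i ord_max = if i == ord_max then x else K i ord_max.
  rewrite EV sum_mulr_delta big1 ?subr0 // => k _.
  by rewrite (ltn_eqF (ltn_ord k)) mulr0.
have Elift i (j : 'I_n) : E i (lift ord_max j) =
   if i == ord_max then 0 else K i (lift ord_max j) - K i (inord j.+1).
  rewrite EV [X in _ - X](eq_bigr (fun k => (if i == ord_max then x else K i k)
    * (k == inord j.+1)%:R)); last first.
    move=> k _; congr (_ * _%:R); by rewrite lift_max -[in RHS]val_eqE /= inordK // ltnS.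
  by rewrite !sum_mulr_delta; case: ifP; rewrite ?subrr.
clearbody E.
(* The last row is now (0, ..., 0, x). The remaining minor is lower triangular with diagonal [a], as
   min(i, j + 1) - min(i, j) vanishes for i <= j. *)
rewrite (expand_det_row _ ord_max) (bigD1 ord_max) //= big1 ?addr0; last first.
  move=> j; case: (unliftP ord_max j) => [k -> _|->]; last by rewrite eqxx.
  by rewrite Elift eqxx mul0r.
rewrite Emax eqxx; congr (_ * _).
have Eij (i j : 'I_n) : row' ord_max (col' ord_max E) i j =
    a (lift ord_max i) * ((i == j)%:R - (i == j.+1 :> nat)%:R)
    + rho * (minn i.+1 j.+2 - minn i.+1 j.+1)%N%:R * (m (lift ord_max i))%:R.
  rewrite [LHS]mxE [LHS]mxE Elift eq_sym (negPf (neq_lift _ _)) !mxE.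
  have -> : (lift ord_max i == inord j.+1) = (i == j.+1 :> nat).
    by rewrite -val_eqE [val (lift _ _)]lift_max /= inordK // ltnS.
  have -> : (lift ord_max i == lift ord_max j) = (i == j :> nat).
    by rewrite (inj_eq (@lift_inj _ _)).
  rewrite inordK ?ltnS // !lift_max natrB; first by ring.
  lia.
rewrite /cofactor addnn -mul2n exprM sqrrN expr1n expr1n mul1r det_trig.
  apply: eq_bigr => i _; rewrite Eij eqxx (ltn_eqF (ltnSn i)).
  have -> : (minn i.+1 i.+2 - minn i.+1 i.+1 = 0)%N by lia.
  by rewrite mulr0 mul0r addr0 subr0 mulr1.
apply/is_trig_mxP => i j ij; rewrite Eij -val_eqE /= (ltn_eqF ij) (ltn_eqF (leqW ij)).
have -> : (minn i.+1 j.+2 - minn i.+1 j.+1 = 0)%N by lia.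
by rewrite mulr0 mul0r addr0 subrr mulr0.
Qed.

(** Reduces to [det_diag_sub_min] row by row: for [m i] nonzero a factor [rise (a i + 1) (m i).-1]
    comes out, and for [m i = 0] the identity row is scaled by [a i], which is cancelled
    afterwards. *)
Lemma det_hua_mx (R : idomainType) n (rho x : R) (m : 'X_{1..n.+1}) (a : 'I_n.+1 -> R) :
  (forall j, a j = x + rho * (\sum_(i < n.+1) minn i.+1 j.+1 * m i)%:R) ->
  (forall j, a j != 0) -> m ord_max != 0%N ->
  \det (hua_mx rho m a) = x * rise (a ord_max + 1) (m ord_max).-1 *
     \prod_(i < n) rise (a (lift ord_max i)) (m (lift ord_max i)).
Proof.
move=> ha a0 m0.
pose c := \row_i (if m i == 0%N then a i else 1).
pose d := \row_i (if m i == 0%N then 1 else rise (a i + 1) (m i).-1).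
have := congr1 determinant (_ : diag_mx c *m hua_mx rho m a = diag_mx d *m
   \matrix_(i, j) (a i * (i == j)%:R - rho * (minn i.+1 j.+1)%:R * (m i)%:R)).
rewrite !det_mulmx !det_diag (det_diag_sub_min ha) => H.
have c0 : \prod_i c 0 i != 0.
  by apply/prodf_neq0 => i _; rewrite mxE; case: ifP => // _; rewrite oner_neq0.
apply: (mulfI c0); rewrite H; last first.
  apply/matrixP => i j; rewrite !mul_diag_mx !mxE.
  case: (m i) => [|k] /=; first by rewrite /rise big_ord0; ring.
  by rewrite riseSl; ring.
rewrite [in LHS](bigD1_ord ord_max) // [in RHS](bigD1_ord ord_max) //= !mxE (negPf m0).
set D := \prod_(i < n) d _ _; set A := \prod_(i < n) a _.
set C := \prod_(i < n) c _ _; set B := \prod_(i < n) rise _ _.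
have E : D * A = C * B.
  rewrite -!big_split /=; apply: eq_bigr => i _.
  rewrite !mxE; case: (m _) => [|k] /=; first by rewrite /rise big_ord0; ring.
  by rewrite riseSl; ring.
transitivity (x * rise (a ord_max + 1) (m ord_max).-1 * (D * A)); first by ring.
by rewrite E; ring.
Qed.

(** * The logarithm of Hua at q = 1 *)

Section Limit.
Variables (N g : nat).
Implicit Types (t m : 'X_{1..N}) (i : 'I_N).
Local Notation rho := ((2 * g)%:R : rat).

Definition mfact m : rat := \prod_i (m i)`!%:R.

Lemma mfact_neq0 m : mfact m != 0.
Proof. by apply/prodf_neq0 => i _; rewrite pnatr_eq0 -lt0n fact_gt0. Qed.

Lemma mfactD1 m i : mfact (m + U_(i)) = (m i).+1%:R * mfact m.
Proof.
rewrite /mfact (bigD1 i) //= [in RHS](bigD1 i) //= mnmDE mnm1E eqxx addn1.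
rewrite factS natrM mulrA; congr (_ * _); apply: eq_bigr => j /negPf h.
by rewrite mnmDE mnm1E eq_sym h addn0.
Qed.

Definition ratio_lim (t : 'I_N -> rat) m : rat :=
  \det (hua_mx rho m (fun j => t j + rho * (H_row j m)%:R)) / mfact m.

Lemma ratio_lim_at0 (t : 'I_N -> rat) : ratio_lim t 0%MM = 1.
Proof.
rewrite /ratio_lim (_ : hua_mx _ _ _ = 1%:M) ?det1 ?mul1r.
  by rewrite /mfact big1 ?invr1 // => i _; rewrite mnm0E.
apply/matrixP => i j; rewrite !mxE mnm0E /rise big_ord0 mul0r mulr0 subr0.
by rewrite mul1r.
Qed.

Lemma ratio_lim0 m : ratio_lim (fun=> 0) m = (m == 0%MM)%:R.
Proof.
have [->|m0] := eqVneq m 0%MM; first exact: ratio_lim_at0.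
rewrite /ratio_lim det_hua_mx_eq0 ?mul0r // => j; rewrite add0r; congr (_ * _%:R).
by apply: eq_bigr => k _; rewrite minnC.
Qed.

Lemma ratio_lim_step0 (t t' : 'I_N -> rat) m i : m i = 0%N ->
  (forall j, j != i -> t j = t' j) -> ratio_lim t m = ratio_lim t' m.
Proof.
move=> mi0 tt'; congr (\det _ / _); apply/matrixP => k l; rewrite !mxE.
have [->|ki] := eqVneq k i; last by rewrite tt'.
by rewrite mi0 /rise !big_ord0 !mul0r.
Qed.

Lemma ratio_lim_step (t : 'I_N -> rat) m i :
  ratio_lim (fun j => t j + (i == j)%:R) (m + U_(i)) - ratio_lim t (m + U_(i))
  = ratio_lim (fun j => t j + (i == j)%:R + (2 * g * minn i.+1 j.+1)%:R) m.
Proof.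
rewrite /ratio_lim mfactD1 -mulrBl.
(* All arguments are expressed by [a]: H_j(m + e_i) exceeds H_j(m) by min(i, j), which is exactly
   compensated by the shift of [t] by rho H_i. *)
set a := fun j => t j + (i == j)%:R + (2 * g * minn i.+1 j.+1)%:R + rho * (H_row j m)%:R.
have -> : (fun j => t j + (i == j)%:R + rho * (H_row j (m + U_(i)))%:R) = a.
  apply: functional_extensionality => j; rewrite H_rowD1 /a natrD natrM; ring.
have -> : (fun j => t j + rho * (H_row j (m + U_(i)))%:R) = fun j => a j - (i == j)%:R.
  apply: functional_extensionality => j; rewrite H_rowD1 /a natrD natrM; ring.
rewrite det_hua_mx_step invfM mulrACA divff ?mul1r // pnatr_eq0 //.
Qed.

(** Induction on the degree of [m], then on that of [t]. The recurrence may enlarge [t], but only in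
    the term where [m] has dropped; the power of [q] in front has value 1. *)
Lemma hua_ratio_value t m :
  frac_value (hua_ratio g t m) 1 (ratio_lim (fun j => (t j)%:R) m).
Proof.
have [n] := ubnP (mdeg m); elim: n m t => // n IHn m t mn.
have [k] := ubnP (mdeg t); elim: k t => // k IHk t tk.
have [->|t0] := eqVneq t 0%MM.
  rewrite hua_ratio0 (_ : (fun j => _) = fun=> 0); last first.
    by apply: functional_extensionality => j; rewrite mnm0E.
  by rewrite ratio_lim0; apply: frac_value_nat.
have [i ti] := mnm_neq0_ex t0.
move: tk; rewrite -(mnm_subK1 ti) mdegD mdeg1; set t' := (t - U_(i))%MM => tk.
have IHt : frac_value (hua_ratio g t' m) 1 (ratio_lim (fun j => (t' j)%:R) m).
  by apply: IHk; lia.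
have [mi|mi] := eqVneq (m i) 0%N.
  rewrite hua_ratio_step0 //.
  rewrite (ratio_lim_step0 (t' := fun j => (t' j)%:R) mi) //.
  by move=> j /negPf h; rewrite mnmDE mnm1E eq_sym h addn0.
move: mn IHt; rewrite -(mnm_subK1 mi) mdegD mdeg1; set m' := (m - U_(i))%MM => mn IHt.
rewrite -[hua_ratio _ _ _](subrK (hua_ratio g t' (m' + U_(i))%MM)).
rewrite -[ratio_lim _ _](subrK (ratio_lim (fun j => (t' j)%:R) (m' + U_(i))%MM)).
apply: frac_valueD IHt; rewrite hua_ratio_step.
have -> : (fun j => ((t' + U_(i))%MM j)%:R) = fun j => (t' j)%:R + (i == j)%:R :> rat.
  by apply: functional_extensionality => j; rewrite mnmDE mnm1E natrD.
rewrite ratio_lim_step -[ratio_lim _ _]mul1r; apply: frac_valueM; first exact: frac_value_qX.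
have -> : (fun j => (t' j)%:R + (i == j)%:R + (2 * g * minn i.+1 j.+1)%:R)
    = fun j => ((t' + U_(i) + H_shift g i)%MM j)%:R :> rat.
  by apply: functional_extensionality => j; rewrite !mnmDE mnm1E [H_shift _ _ _]mnmE !natrD.
by apply: IHn; move: mn; rewrite addn1 ltnS.
Qed.

Definition mconst c : 'X_{1..N} := [multinom c | _ < N].

Lemma mdot_const c m : mdot (mconst c) m = (c * mdeg m)%N.
Proof. by rewrite mdegE big_distrr; apply: eq_bigr => i _; rewrite mnmE. Qed.

Lemma mps_scaleM t (F G : mpseries N) :
  mps_scale t (mps_mul F G) = mps_mul (mps_scale t F) (mps_scale t G).
Proof.
apply: functional_extensionality => m; rewrite /mps_scale mulr_sumr.
apply: eq_bigr => k /eqP E.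
have -> : mdot t m = (mdot t k.1 + mdot t k.2)%N by rewrite -mdotDr -E.
by rewrite exprD mulrACA.
Qed.

Local Notation F := (@Hua N g.+1).
Local Notation L := (mps_log F).

(** Logarithmic derivative of F_t / F; for constant [t] the scaling multiplies degree d by q^(c
    d). *)
Lemma hua_ratio_euler c m :
  mps_euler (hua_ratio g (mconst c)) m
    = mps_mul (hua_ratio g (mconst c))
        (fun a => (q ^+ (c * mdeg a) - 1) * mps_euler L a) m.
Proof.
set t := mconst c.
have EF : mps_euler F = mps_mul F (mps_euler L).
  by rewrite (mps_euler_log (Hua0 _ _)) mps_mulCA (mps_mulV (Hua0 _ _)) mps_mul1r.
have Et : mps_euler (mps_scale t F) = mps_mul (mps_scale t F) (mps_scale t (mps_euler L)).
  rewrite -mps_scaleM -EF; apply: functional_extensionality => u.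
  by rewrite /mps_euler /mps_scale mulrCA.
rewrite /hua_ratio mps_eulerM Et (mps_eulerV (Hua0 _ _)).
have -> : (fun a => (q ^+ (c * mdeg a) - 1) * mps_euler L a)
    = fun a => mps_scale t (mps_euler L) a - mps_euler L a.
  apply: functional_extensionality => u.
  by rewrite /mps_scale mdot_const mulrBl mul1r.
rewrite mps_mulBr -!mps_mulA (mps_mulC (mps_inv F)).
congr (_ + _); first by congr (mps_mul _ _ m); exact: mps_mulC.
rewrite -[RHS]mulN1r -mps_mulZr; congr (mps_mul _ _ m).
by apply: functional_extensionality => u; rewrite mulN1r.
Qed.

Lemma frac_value_geom c : frac_value (\sum_(i < c) q ^+ i) 1 c%:R.
Proof.
rewrite -[c in c%:R]card_ord -sumr_const; apply: frac_value_sum => i _.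
exact: frac_value_qX.
Qed.


(** The limit of r_m(c, ..., c) as a polynomial in c = ['X], so that it can be differentiated at c =
    0. *)
Definition lim_poly m : {poly rat} :=
  (mfact m)^-1 *: \det (hua_mx rho%:P m (fun j => 'X + (rho * (H_row j m)%:R)%:P)).

Lemma horner_rise (p : {poly rat}) k x : (rise p k).[x] = rise p.[x] k.
Proof.
rewrite /rise horner_prod; apply: eq_bigr => i _.
by rewrite hornerD -polyC_natr hornerC.
Qed.

Lemma horner_lim_poly m x : (lim_poly m).[x] = ratio_lim (fun=> x) m.
Proof.
rewrite /lim_poly hornerZ mulrC; congr (_ / _).
rewrite -[LHS]/(horner_eval x _) -det_map_mx; congr (\det _).
apply/matrixP => i j; rewrite !mxE /= /horner_eval -!polyC_natr.
by rewrite !(hornerE, horner_rise).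
Qed.

Definition log_lim m : rat := (lim_poly m)^`().[0] / (mdeg m)%:R.

Lemma poly_nat_eq (p r : {poly rat}) :
  (forall c : nat, p.[c%:R] = r.[c%:R]) -> p = r.
Proof.
move=> h; apply/eqP; rewrite -subr_eq0; apply/eqP.
apply: (@roots_geq_poly_eq0 _ _ [seq c%:R | c <- iota 0 (size (p - r))]).
- by apply/allP => x /mapP [c _ ->]; rewrite rootE hornerD hornerN h subrr.
- by rewrite map_inj_uniq ?iota_uniq // => a b /eqP; rewrite eqr_nat => /eqP.
- by rewrite size_map size_iota.
Qed.

Lemma hua_ratio_const_value c m :
  frac_value (hua_ratio g (mconst c) m) 1 (lim_poly m).[c%:R].
Proof.
rewrite horner_lim_poly (_ : (fun=> c%:R) = fun j => (mconst c j)%:R).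
  exact: hua_ratio_value.
by apply: functional_extensionality => j; rewrite mnmE.
Qed.

Lemma hua_ratio_at0 t : hua_ratio g t 0%MM = 1.
Proof.
transitivity (mps_mul F (mps_inv F) 0%MM).
  apply: mps_mul_local => // k; rewrite mdeg0 leqn0 mdeg_eq0 => /eqP ->.
  by rewrite /mps_scale /mdot big1 ?mul1r // => i _; rewrite mnm0E muln0.
by rewrite (mps_mulV (Hua0 _ _)) /mps_one eqxx.
Qed.

Lemma log_shift_value c m v : frac_value ((q - 1) * L m) 1 v ->
  frac_value ((q ^+ (c * mdeg m) - 1) * mps_euler L m) 1
    (c%:R * ((mdeg m)%:R * ((mdeg m)%:R * v))).
Proof.
move=> h; have -> : (q ^+ (c * mdeg m) - 1) * mps_euler L m
    = (\sum_(i < c * mdeg m) q ^+ i) * ((mdeg m)%:R * ((q - 1) * L m)).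
  by rewrite subrX1 /mps_euler; ring.
rewrite [c%:R * _]mulrA -natrM; apply: frac_valueM; first exact: frac_value_geom.
by apply: frac_valueM => //; exact: frac_value_nat.
Qed.

(** Induction on the degree. In D r = r D(L_t - L) the coefficient at [m] isolates [L m], since r
    has constant term 1. The case c = 1 shows regularity with some value; comparing all c gives a
    polynomial identity whose derivative at 0 determines that value. *)
Lemma mps_log_value m : frac_value ((q - 1) * L m) 1 (log_lim m).
Proof.
have [n] := ubnP (mdeg m); elim: n m => // n IH m mn.
have [->|m0] := eqVneq m 0%MM.
  (* At [m = 0] the convention [0^-1 = 0] makes [log_lim] zero, as required. *)
  rewrite /mps_log mdeg0 big_geq // mulr0 /log_lim mdeg0 invr0 mulr0.
  exact: (frac_value_nat 0).
set d := mdeg m; have d0 : d%:R != 0 :> rat by rewrite pnatr_eq0 mdeg_eq0.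
have d_gt : (mdeg (0%MM : 'X_{1..N}) < d.+1)%N by rewrite mdeg0.
(* [k0] is the splitting m = 0 + m, whose term contains [L m]; under [P] the second component has
   smaller degree. *)
pose k0 : 'X_{1..N < d.+1, d.+1} := (BMultinom d_gt, BMultinom (ltnSn d)).
pose P (k : 'X_{1..N < d.+1, d.+1}) := (m == (k.1 + k.2)%MM) && (k != k0).
have Pk1 k : P k -> (k.1 : 'X_{1..N}) != 0%MM.
  case: k => k1 k2 /andP[/= /eqP E]; apply: contraNneq => k10.
  by rewrite xpair_eqE !bmeqP /= k10 E k10 add0m !eqxx.
have Pk2 k : P k -> (mdeg k.2 < d)%N.
  move=> Pk; have := Pk1 _ Pk; move: Pk => /andP[/eqP E _].
  by have := congr1 (@mdeg _) E; rewrite mdegD -/d -mdeg_eq0; lia.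
pose w (k : 'X_{1..N < d.+1, d.+1}) : rat := (mdeg k.2)%:R * ((mdeg k.2)%:R * log_lim k.2).
have Lt_val c : frac_value ((q ^+ (c * d) - 1) * mps_euler L m) 1
   (d%:R * (lim_poly m).[c%:R] - \sum_(k | P k) (lim_poly k.1).[c%:R] * (c%:R * w k)).
  have := hua_ratio_euler c m.
  rewrite /mps_mul (bigD1 k0) /=; last by rewrite add0m.
  rewrite hua_ratio_at0 mul1r => /eqP; rewrite -subr_eq => /eqP <-.
  apply: frac_valueB.
    by apply: frac_valueM; [exact: frac_value_nat | exact: hua_ratio_const_value].
  apply: frac_value_sum => k Pk; apply: frac_valueM; first exact: hua_ratio_const_value.
  by apply: log_shift_value; apply: IH; apply: leq_trans (Pk2 _ Pk) _.
pose v := d%:R * (lim_poly m).[1%:R] - \sum_(k | P k) (lim_poly k.1).[1%:R] * (1%:R * w k).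
have val : frac_value ((q - 1) * L m) 1 (v / (d%:R * d%:R)).
  have G := frac_valueM (frac_value_geom d) (frac_value_nat d 1).
  have G0 : (\sum_(i < d) q ^+ i) * d%:R != 0.
    apply: contra_neq (mulf_neq0 d0 d0) => G0.
    by apply: (frac_value_uniq G); rewrite G0; exact: (frac_value_nat 0).
  have -> : (q - 1) * L m = (q ^+ (1 * d) - 1) * mps_euler L m / ((\sum_(i < d) q ^+ i) * d%:R).
    by apply: (canRL (mulfK G0)); rewrite mul1n subrX1 /mps_euler; ring.
  apply: frac_valueM; first exact: Lt_val.
  by apply: frac_valueV G; rewrite mulf_neq0.
suff -> : log_lim m = v / (d%:R * d%:R) by [].
have H : d%:R *: lim_poly m = 'X * (\sum_(k | P k) w k *: lim_poly k.1 + v%:P).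
  apply: poly_nat_eq => c; rewrite hornerZ hornerM hornerX hornerD hornerC horner_sum.
  have := frac_value_uniq (Lt_val c) (log_shift_value c val).
  move/(canRL (subrK _)); rewrite -/d => ->.
  rewrite mulrDr mulr_sumr addrC; congr (_ + _).
    apply: eq_bigr => k _; rewrite (hornerZ (w k)); ring.
  by field; rewrite d0.
(* At c = 0 the derivative of the right-hand side is its second factor, where each [lim_poly k.1]
   vanishes because [k.1] is nonzero. Only [v] survives. *)
have := congr1 (fun p => p^`().[0]) H.
rewrite (derivZ d%:R) derivM derivX (hornerZ d%:R) hornerD.
rewrite !hornerM hornerX hornerC mul1r mul0r addr0.
rewrite hornerD hornerC horner_sum big1 ?add0r; last first.
  by move=> k Pk; rewrite (hornerZ (w k)) horner_lim_poly ratio_lim0 (negPf (Pk1 _ Pk)) mulr0.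
by rewrite /log_lim -/d => <-; field; rewrite d0.
Qed.

End Limit.

(** * Degree and leading coefficient in rho *)

Section Explicit.
Variable n : nat.
Implicit Types (m : 'X_{1..n.+1}).

Definition rise_lin (c b : rat) k : {poly rat} := rise (c *: 'X + b%:P) k.

(** The closed form of the opening comment, divided by |m|, with ['X] standing for rho. *)
Definition log_poly m : {poly rat} :=
  ((mdeg m)%:R * mfact m)^-1 *:
    (rise_lin (H_row ord_max m)%:R 1 (m ord_max).-1 *
     \prod_(i < n) rise_lin (H_row (lift ord_max i) m)%:R 0 (m (lift ord_max i))).

Lemma horner_rise_lin c b k x : (rise_lin c b k).[x] = rise (c * x + b) k.
Proof. by rewrite horner_rise hornerD hornerZ hornerX hornerC. Qed.

(** Over [{poly rat}] the determinant is ['X] times a cofactor, so its derivative at 0 is that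
    cofactor at 0. The [a j] are monic of degree 1 there, hence nonzero even when rho is 0. *)
Lemma log_limE g m : m ord_max != 0%N ->
  log_lim g m = (log_poly m).[(2 * g)%:R].
Proof.
move=> m0; rewrite /log_lim /lim_poly (@det_hua_mx _ _ _ 'X) //; last 2 first.
- move=> j; congr (_ + _); rewrite polyCM !polyC_natr; congr (_ * _%:R).
  by apply: eq_bigr => k _; rewrite minnC.
- by move=> j; rewrite -size_poly_eq0 size_XaddC.
rewrite -mulrA derivZ derivM derivX mul1r hornerZ hornerD.
rewrite [('X * _).[_]]hornerM hornerX mul0r addr0.
rewrite /log_poly hornerZ invfM mulrAC [in RHS](mulrC _^-1).
congr (_ * _).
rewrite [LHS]hornerM [RHS]hornerM horner_rise horner_rise_lin !horner_prod.
congr (_ * _).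
  congr rise; rewrite !hornerE; ring.
apply: eq_bigr => i _; rewrite horner_rise horner_rise_lin; congr rise.
by rewrite !hornerE; ring.
Qed.

Lemma rise_lin_lead c b k : c != 0 ->
  size (rise_lin c b k) = k.+1 /\ lead_coef (rise_lin c b k) = c ^+ k.
Proof.
move=> c0; have szl d : size (c *: 'X + d%:P) = 2%N.
  by rewrite size_polyDl size_scale // size_polyX // (leq_ltn_trans (size_polyC_leq1 _)).
have lcl d : lead_coef (c *: 'X + d%:P) = c.
  rewrite lead_coefDl ?lead_coefZ ?lead_coefX ?mulr1 //.
  by rewrite size_scale // size_polyX (leq_ltn_trans (size_polyC_leq1 _)).
elim: k => [|k [IHs IHl]]; first by rewrite /rise_lin /rise big_ord0 size_poly1 lead_coef1.
rewrite /rise_lin riseSr -/(rise_lin c b k).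
rewrite -addrA -polyC_natr -polyCD.
rewrite lead_coefM IHl lcl exprSr size_mul ?IHs ?szl ?addn2 //.
- by rewrite -size_poly_eq0 IHs.
- by rewrite -size_poly_eq0 szl.
Qed.

(** Every P_i(m) is positive because the last multiplicity is, so each factor keeps its degree. The
    exponent [(m ord_max).-1] accounts for both the degree |m| - 1 and the division by P_N. *)
Lemma log_poly_lead m : m ord_max != 0%N ->
  size (log_poly m) = mdeg m /\
  lead_coef (log_poly m) = ((mdeg m)%:R * (H_row ord_max m)%:R)^-1 *
     \prod_i ((H_row i m)%:R ^+ m i / (m i)`!%:R).
Proof.
move=> m0; have d0 : mdeg m != 0%N.
  by rewrite mdeg_eq0; apply: contra_neq m0 => ->; rewrite mnm0E.
have H0 i : (H_row i m)%:R != 0 :> rat.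
  rewrite pnatr_eq0 /H_row (bigD1 ord_max) //= addn_eq0 muln_eq0 (negPf m0) orbF.
  by rewrite negb_and; apply/orP; left; lia.
have [s1 l1] := rise_lin_lead 1 (m ord_max).-1 (H0 ord_max).
have s2 i := (rise_lin_lead 0 (m (lift ord_max i)) (H0 (lift ord_max i))).1.
have l2 i := (rise_lin_lead 0 (m (lift ord_max i)) (H0 (lift ord_max i))).2.
have n2 i : rise_lin (H_row (lift ord_max i) m)%:R 0 (m (lift ord_max i)) != 0.
  by rewrite -size_poly_eq0 s2.
split.
  rewrite size_scale ?invr_eq0 ?mulf_neq0 ?mfact_neq0 ?pnatr_eq0 //.
  rewrite size_mul; last 2 first.
  - by rewrite -size_poly_eq0 s1.
  - by apply/prodf_neq0.
  rewrite s1 size_prod // (eq_bigr (fun i => (m (lift ord_max i) + 1)%N)); last first.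
    by move=> i _; rewrite s2 addn1.
  rewrite big_split /= sum_nat_const card_ord muln1 mdegE (bigD1_ord ord_max) //=.
  lia.
rewrite lead_coefZ lead_coefM l1 lead_coef_prod (eq_bigr _ (fun i _ => l2 i)).
rewrite big_split /= prodfV -/(mfact m) (bigD1_ord ord_max) //= !invfM.
rewrite -[in RHS](prednK (n := m ord_max)) ?lt0n // exprS.
by field; rewrite H0 mfact_neq0 pnatr_eq0.
Qed.

End Explicit.

(** * The plethystic logarithm at q = 1 *)

Definition mnm_div N (m : 'X_{1..N}) k : 'X_{1..N} := [multinom (m i %/ k)%N | i < N].

(** One division by [k] is the coefficient in Log, the other comes from [frac_value_psi]. *)
Lemma A_mult_value N g (m : 'X_{1..N}) :
  frac_value (A_mult g.+1 m) 1
    (\sum_(1 <= k < (mdeg m).+1) (moebius k)%:~R / k%:R *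
      (if [forall i, k %| m i]%N then log_lim g (mnm_div m k) / k%:R else 0)).
Proof.
rewrite /A_mult /mps_Log mulr_sumr !big_add1 !big_mkord.
apply: frac_value_sum => k _; rewrite mulrCA; apply: frac_valueM.
  apply: frac_valueM; first exact: frac_value_int.
  by apply: frac_valueV; [rewrite pnatr_eq0 | exact: frac_value_nat].
rewrite /mps_psi; case: ifP => _; last by rewrite mulr0; exact: (frac_value_nat 0).
by apply: frac_value_psi => //; exact: mps_log_value.
Qed.

Section APoly.
Variable n : nat.
Implicit Types (m : 'X_{1..n.+1}).

Definition A_poly m : {poly rat} :=
  \sum_(1 <= k < (mdeg m).+1) if [forall i, k %| m i]%N
    then ((moebius k)%:~R / k%:R / k%:R) *: log_poly (mnm_div m k) else 0.

Lemma A_polyE g m : m ord_max != 0%N ->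
  frac_value (A_mult g.+1 m) 1 (A_poly m).[(2 * g)%:R].
Proof.
move=> m0; suff -> : (A_poly m).[(2 * g)%:R] = \sum_(1 <= k < (mdeg m).+1)
    (moebius k)%:~R / k%:R *
      (if [forall i, k %| m i]%N then log_lim g (mnm_div m k) / k%:R else 0).
  exact: A_mult_value.
rewrite /A_poly horner_sum; apply: eq_big_nat => k /andP[k0 _].
case: ifP => [/forallP kd|_]; last by rewrite horner0 mulr0.
rewrite (hornerZ (_ / _)) log_limE; first by rewrite [RHS]mulrA [RHS]mulrAC.
by rewrite mnmE -lt0n divn_gt0 // dvdn_leq // lt0n.
Qed.

Lemma A_poly_lead m : m ord_max != 0%N ->
  size (A_poly m) = mdeg m /\ lead_coef (A_poly m) = lead_coef (log_poly m).
Proof.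
move=> m0; have [sz _] := log_poly_lead m0.
have d0 : (0 < mdeg m)%N.
  by rewrite lt0n mdeg_eq0; apply: contra_neq m0 => ->; rewrite mnm0E.
rewrite /A_poly big_ltn ?ltnS // ifT; last by apply/forallP => i; rewrite dvd1n.
have -> : mnm_div m 1 = m by apply/mnmP => i; rewrite mnmE divn1.
rewrite (_ : moebius 1 = 1) // !divr1 scale1r.
set S := \sum_(2 <= k < _) _.
(* For k >= 2 the term comes from a vector of degree |m| / k < |m|, so the term k = 1 alone gives
   the top degree. *)
suff szS : (size S < size (log_poly m))%N by rewrite size_polyDl ?lead_coefDl.
rewrite sz -(prednK d0) ltnS /S big_seq;
apply: (big_ind (fun p : {poly rat} => (size p <= (mdeg m).-1)%N)).
- by rewrite size_poly0.
- by move=> p r hp hr; apply: leq_trans (size_polyD _ _) _; rewrite geq_max hp.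
- move=> k; rewrite mem_index_iota => /andP[k2 _].
  case: ifP => [/forallP kd|_]; last by rewrite size_poly0.
  have kE : (mdeg (mnm_div m k) * k)%N = mdeg m.
    rewrite !mdegE big_distrl; apply: eq_bigr => i _ /=.
    by rewrite mnmE divnK.
  have mk0 : mnm_div m k ord_max != 0%N.
    rewrite -lt0n mnmE divn_gt0; last exact: ltnW.
    by apply: dvdn_leq (kd _); rewrite lt0n.
  apply: leq_trans (size_scale_leq _ _) _; rewrite (log_poly_lead mk0).1.
  move: d0; rewrite -kE muln_gt0 => /andP[e0 _].
  have k0 : (0 < k)%N := ltnW k2.
  by rewrite -ltnS prednK ?muln_gt0 ?e0 // ltn_Pmulr.
Qed.

End APoly.

(** * Return to the variable g and to partitions *)

Lemma corollary_multinom n (m : 'X_{1..n.+1}) : m ord_max != 0%N ->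
  exists p : {poly rat},
    [/\ forall g : nat, (1 <= g)%N -> frac_value (A_mult g m) 1 p.[g%:R],
        p <> 0 /\ (size p).-1 = (mdeg m - 1)%N
      & lead_coef (p \Po (2^-1 *: 'X + 1)) =
          ((mdeg m)%:R * (H_row ord_max m)%:R)^-1 *
     \prod_i ((H_row i m)%:R ^+ m i / (m i)`!%:R)].
Proof.
move=> m0; have [sz lc] := A_poly_lead m0; have [_ ll] := log_poly_lead m0.
have d0 : mdeg m != 0%N.
  by rewrite mdeg_eq0; apply: contra_neq m0 => ->; rewrite mnm0E.
have szl : size (2%:P * 'X - 2%:P : {poly rat}) = 2%N.
  by rewrite -polyCN size_MXaddC polyC_eq0 /= size_polyC.
have szp : size (A_poly m \Po (2%:P * 'X - 2%:P)) = mdeg m.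
  by rewrite size_comp_poly2.
(* Substitutes rho = 2 g - 2; the substitution g = rho / 2 + 1 in the conclusion is its inverse. *)
exists (A_poly m \Po (2%:P * 'X - 2%:P)); split.
- case=> // g _; rewrite horner_comp !hornerE.
  rewrite (_ : _ - _ = (2 * g)%:R); first exact: A_polyE.
  by rewrite natrM -natr1; ring.
- by rewrite szp subn1; split=> //; apply/eqP; rewrite -size_poly_eq0 szp.
- have E : (2%:P * 'X - 2%:P) \Po (2^-1 *: 'X + 1) = 'X :> {poly rat}.
    rewrite comp_polyB comp_polyM !comp_polyC comp_polyX mulrDr mulr1 addrK.
    by rewrite mul_polyC scalerA divff // scale1r.
  by rewrite -comp_polyA E comp_polyXr lc.
Qed.

Lemma sum_count_mem (s : seq nat) h : all (fun i => 0 < i <= h)%N s ->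
  (\sum_(1 <= i < h.+1) count_mem i s = size s)%N.
Proof.
elim: s => [|x s IH] /=; first by rewrite big1.
move=> /andP[/andP[x0 xh] /IH <-]; rewrite big_split /= -[RHS]add1n; congr (_ + _)%N.
rewrite (bigD1_seq x) ?iota_uniq ?mem_index_iota ?x0 //= eqxx big1 ?addn0 //.
by move=> i /negPf; rewrite eq_sym => ->.
Qed.

Theorem corollary1p0p2 (la : seq nat) (la_part : is_partition la)
    (la_neq0 : la <> [::]) :
  exists p : {poly rat},
    [/\ (* p.[g] is the value of A_la at q = 1 *)
        forall g : nat, (1 <= g)%N -> frac_value (A_part g la) 1 p.[g%:R],
        (* p has degree l(la) - 1 *)
        p <> 0 /\ (size p).-1 = (size la - 1)%N
      & (* leading coefficient of p in rho = 2 g - 2, i.e. g = rho / 2 + 1 *)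
        lead_coef (p \Po (2^-1 *: 'X + 1)) =
          ((Pmin la 1)%:R * (Pmin la (largest_part la))%:R)^-1 *
          \prod_(1 <= i < (largest_part la).+1)
             ((Pmin la i)%:R ^+ mult la i / (mult la i)`!%:R)].
Proof.
have [h_gt0 h_in la_le] : [/\ (0 < largest_part la)%N, largest_part la \in la
    & all (fun i => 0 < i <= largest_part la)%N la].
  move: la_part; case: la la_neq0 => // x s _ /andP[/= srt].
  rewrite inE negb_or eq_sym -lt0n => /andP[x0 s0]; split=> //; first by rewrite mem_head.
  rewrite /= x0 leqnn; apply/allP => y ys.
  have /allP/(_ _ ys) yx := order_path_min (rev_trans leq_trans) srt.
  by rewrite [(y <= x)%N]yx andbT lt0n; apply: contraNneq s0 => <-.
have := sum_count_mem la_le; rewrite /A_part /Pmin.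
have : mult la (largest_part la) != 0%N by rewrite /mult -lt0n -has_count has_pred1.
move: (largest_part la) h_gt0 => [//|n] _ multn sumla.
set m := [multinom _ | _ < _].
have [|p [h1 h2 h3]] := @corollary_multinom n m; first by rewrite mnmE.
have dm : mdeg m = size la.
  rewrite -sumla mdegE big_add1 big_mkord; apply: eq_bigr => i _; exact: mnmE.
have Pm k : (\sum_(1 <= j < n.+2) minn k.+1 j * mult la j)%N
      = (\sum_(j < n.+1) minn k.+1 j.+1 * m j)%N.
  by rewrite big_add1 big_mkord; apply: eq_bigr => j _; rewrite mnmE.
(* As min(1, j) = 1, P_1(m) is the number of parts, so the factor 1 / |m| becomes 1 / P_1(m). *)
have P1 : (\sum_(1 <= j < n.+2) minn 1 j * mult la j)%N = mdeg m.
  rewrite Pm mdegE; apply: eq_bigr => j _.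
  by rewrite (minn_idPl _) // mul1n.
exists p; split=> //; first by rewrite -dm.
rewrite h3 P1 Pm big_add1 big_mkord; congr (_ * _).
by apply: eq_bigr => i _; rewrite Pm mnmE.
Qed.
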